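(* Let $(\mathfrak g,[\cdot,\cdot,\cdot]_{\mathfrak g})$ be a finite-dimensional real $3$-Lie algebra. Then $\mathfrak g$ has a complex structure if and only if its complexification $\mathfrak g_{\mathbb C}$ admits a decomposition $\mathfrak g_{\mathbb C}=\mathfrak q\oplus\mathfrak p$ (direct sum of vector spaces), where $\mathfrak q$ and $\mathfrak p=\sigma(\mathfrak q)$ are complex subalgebras of $\mathfrak g_{\mathbb C}$.
   Context: A $3$-Lie algebra is a vector space $\mathfrak g$ with a trilinear skew-symmetric bracket $[\cdot,\cdot,\cdot]_{\mathfrak g}$ satisfying $[x,y,[z,w,v]]=[[x,y,z],w,v]+[z,[x,y,w],v]+[z,w,[x,y,v]]$. The complexification $\mathfrak g_{\mathbb C}=\mathfrak g\otimes_{\mathbb R}\mathbb C=\{x+iy\mid x,y\in\mathfrak g\}$ is a complex $3$-Lie algebra with the complex-trilinear extension of the bracket; $\sigma(x+iy)=x-iy$ ($x,y\in\mathfrak g$) is the conjugation of $\mathfrak g_{\mathbb C}$ with respect to $\mathfrak g$. An almost complex structure on $\mathfrak g$ is a linear map $J:\mathfrak g\to\mathfrak g$ with $J^2=-\mathrm{Id}$. It is a complex structure if for all $x,y,z\in\mathfrak g$ $$J[x,y,z]_{\mathfrak g}=-[Jx,Jy,Jz]_{\mathfrak g}+[Jx,y,z]_{\mathfrak g}+[x,Jy,z]_{\mathfrak g}+[x,y,Jz]_{\mathfrak g}+J[Jx,Jy,z]_{\mathfrak g}+J[x,Jy,Jz]_{\mathfrak g}+J[Jx,y,Jz]_{\mathfrak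 g}.$$ *)

(* Defs.v *)
From HB Require Import structures.
From mathcomp Require Import all_boot all_order all_algebra.
From mathcomp Require Import ring.
From mathcomp Require Import complex.
From mathcomp Require Import reals.

Set Implicit Arguments.
Unset Strict Implicit.
Unset Printing Implicit Defensive.

Import GRing.Theory VectorInternalTheory.
Local Open Scope ring_scope.
Local Open Scope complex_scope.

(* Skew-symmetry is required for the two adjacent transpositions, which
   generate the symmetric group on the three arguments. *)
Record lie3 (K : fieldType) (V : lmodType K) := Lie3 {
  bracket3 :> V -> V -> V -> V;
  bracket3_linear1 : forall y z, linear (fun x => bracket3 x y z);
  bracket3_linear2 : forall x z, linear (fun y => bracket3 x y z);
  bracket3_linear3 : forall x y, linear (fun z => bracket3 x y z);
  bracket3_skew12 : forall x y z, bracket3 x y z = - bracket3 y x z;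
  bracket3_skew23 : forall x y z, bracket3 x y z = - bracket3 x z y;
  bracket3_fundamental : forall x y z w v,
    bracket3 x y (bracket3 z w v) =
      bracket3 (bracket3 x y z) w v + bracket3 z (bracket3 x y w) v
      + bracket3 z w (bracket3 x y v)
}.

Definition subalgebra3 (K : fieldType) (V : vectType K) (b : lie3 V)
    (U : {vspace V}) : Prop :=
  forall x y z, x \in U -> y \in U -> z \in U -> b x y z \in U.

Definition almost_complex_structure (R : rcfType) (g : vectType R)
    (J : 'End(g)) : Prop :=
  forall x, J (J x) = - x.

Definition complex_structure (R : rcfType) (g : vectType R) (b : lie3 g)
    (J : 'End(g)) : Prop :=
  almost_complex_structure J /\
  forall x y z,
    J (b x y z) =
      - b (J x) (J y) (J z) + b (J x) y z + b x (J y) z + b x y (J z)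
      + J (b (J x) (J y) z) + J (b x (J y) (J z)) + J (b (J x) y (J z)).

(* The pair (x, y) stands for x + iy. *)
Definition complexification (R : rcfType) (g : vectType R) : Type :=
  (g * g)%type.

Section Complexification.
Variables (R : rcfType) (g : vectType R).
Local Notation gC := (complexification g).

HB.instance Definition _ := GRing.Zmodule.copy gC (g * g)%type.

Lemma complexificationP (u v : gC) : u.1 = v.1 -> u.2 = v.2 -> u = v.
Proof. by case: u v => [? ?] [? ?] /= -> ->. Qed.

Let coord (i : 'I_(dim g)) (u : g) : R := v2r u 0 i.

Let coordP (u v : g) : (forall i, coord i u = coord i v) -> u = v.
Proof.
by move=> uv; apply: v2r_inj; apply/rowP => i; apply: uv.
Qed.

Let coordD i u v : coord i (u + v) = coord i u + coord i v.
Proof. by rewrite /coord linearD mxE. Qed.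

Let coordN i u : coord i (- u) = - coord i u.
Proof. by rewrite /coord linearN mxE. Qed.

Let coordZ i a u : coord i (a *: u) = a * coord i u.
Proof. by rewrite /coord linearZ mxE. Qed.

Definition scaleC (a : R[i]) (u : gC) : gC :=
  (Re a *: u.1 - Im a *: u.2, Re a *: u.2 + Im a *: u.1).

Ltac by_coord := apply: complexificationP => /=; apply: coordP => i;
  rewrite ?(coordD, coordN, coordZ) /=; ring.

Lemma scaleCA a b u : scaleC a (scaleC b u) = scaleC (a * b) u.
Proof. case: a b => [? ?] [? ?]; by_coord. Qed.

Lemma scaleC1 : left_id 1 scaleC.
Proof. move=> u; by_coord. Qed.

Lemma scaleCDr : right_distributive scaleC +%R.
Proof. move=> a u v; by_coord. Qed.

Lemma scaleCDl u : {morph scaleC^~ u : a b / a + b}.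
Proof. case=> [? ?] [? ?]; by_coord. Qed.

HB.instance Definition _ :=
  GRing.Zmodule_isLmodule.Build R[i] gC scaleCA scaleC1 scaleCDr scaleCDl.

Lemma complexification_vector_axiom : Vector.axiom (dim g) gC.
Proof.
pose f (u : gC) : 'rV[R[i]]_(dim g) := \row_j
  (v2r u.1 0 j +i* v2r u.2 0 j).
pose h (r : 'rV[R[i]]_(dim g)) : gC :=
  (r2v (map_mx (@Re R) r),
   r2v (map_mx (@Im R) r)).
exists f.
  move=> [a b] u v; apply/rowP => j; rewrite !mxE /=.
  rewrite !(linearD, linearB, linearN, linearZ) /= !mxE.
  by apply/eqP; rewrite eq_complex /=; apply/andP; split; apply/eqP; ring.
exists h => [u | r].
  apply: complexificationP; apply: v2r_inj;
  by rewrite r2vK; apply/rowP => j; rewrite !mxE.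
apply/rowP => j; rewrite mxE /= !r2vK !mxE.
by case: (r 0 j).
Qed.

HB.instance Definition _ :=
  Lmodule_hasFinDim.Build R[i] gC complexification_vector_axiom.

Definition complex_conj (u : gC) : gC := (u.1, - u.2).

Variable b : lie3 g.

(* Real and imaginary parts of the complex-trilinear extension of b. *)
Definition bracket3C (u v w : gC) : gC :=
  (b u.1 v.1 w.1 - b u.1 v.2 w.2 - b u.2 v.1 w.2 - b u.2 v.2 w.1,
   b u.2 v.1 w.1 + b u.1 v.2 w.1 + b u.1 v.1 w.2 - b u.2 v.2 w.2).

Let b1D x x' y z : b (x + x') y z = b x y z + b x' y z.
Proof. by have := bracket3_linear1 b y z 1 x x'; rewrite !scale1r. Qed.
Let b10 y z : b 0 y z = 0.
Proof. by apply: (addIr (b 0 y z)); rewrite -b1D !add0r. Qed.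
Let b1Z a x y z : b (a *: x) y z = a *: b x y z.
Proof. by have := bracket3_linear1 b y z a x 0; rewrite b10 !addr0. Qed.
Let b1N x y z : b (- x) y z = - b x y z.
Proof. by rewrite -scaleN1r b1Z scaleN1r. Qed.
Let b20 x z : b x 0 z = 0.
Proof. by rewrite bracket3_skew12 b10 oppr0. Qed.
Let b30 x y : b x y 0 = 0.
Proof. by rewrite bracket3_skew23 b20 oppr0. Qed.

Lemma bracket3C_linear1 v w : linear (fun u => bracket3C u v w).
Proof.
move=> a u u'; apply: complexificationP => /=; apply: coordP => i;
  rewrite !(b1D, b1N, b1Z) ?(coordD, coordN, coordZ) /=; ring.
Qed.

Lemma bracket3C_skew12 u v w : bracket3C u v w = - bracket3C v u w.
Proof.
by apply: complexificationP => /=; apply: coordP => i;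
  rewrite !(bracket3_skew12 b v.1) !(bracket3_skew12 b v.2)
    ?(coordD, coordN, coordZ) /=; ring.
Qed.

Lemma bracket3C_skew23 u v w : bracket3C u v w = - bracket3C u w v.
Proof.
by apply: complexificationP => /=; apply: coordP => i;
  rewrite !(bracket3_skew23 b _ w.1) !(bracket3_skew23 b _ w.2)
    ?(coordD, coordN, coordZ) /=; ring.
Qed.

Lemma bracket3C_linear2 u w : linear (fun v => bracket3C u v w).
Proof.
move=> a v v'.
by rewrite !(bracket3C_skew12 u) bracket3C_linear1 opprD scalerN.
Qed.

Lemma bracket3C_linear3 u v : linear (fun w => bracket3C u v w).
Proof.
move=> a w w'.
by rewrite !(bracket3C_skew23 u v) bracket3C_linear2 opprD scalerN.
Qed.

Let eq_on_real (f h : gC -> gC) : linear f -> linear h ->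
  (forall x : g, f (x, 0) = h (x, 0)) -> f =1 h.
Proof.
move=> fl hl fh [x y].
have -> : ((x, y) : gC) = 'i *: ((y, 0) : gC) + ((x, 0) : gC).
  by apply: complexificationP => /=; rewrite !(scale0r, scale1r, scaler0) ?subr0;
     rewrite !add0r ?addr0.
by rewrite fl hl !fh.
Qed.

Let linear_sum3 (a : R[i]) (x x' y y' z z' : gC) :
  a *: x + x' + (a *: y + y') + (a *: z + z')
  = a *: (x + y + z) + (x' + y' + z').
Proof. by rewrite !scalerDr (addrACA (a *: x + a *: y)) (addrACA (a *: x)). Qed.

Let bC1 a u u' v w :
  bracket3C (a *: u + u') v w = a *: bracket3C u v w + bracket3C u' v w.
Proof. exact: bracket3C_linear1. Qed.
Let bC2 a u v v' w :
  bracket3C u (a *: v + v') w = a *: bracket3C u v w + bracket3C u v' w.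
Proof. exact: bracket3C_linear2. Qed.
Let bC3 a u v w w' :
  bracket3C u v (a *: w + w') = a *: bracket3C u v w + bracket3C u v w'.
Proof. exact: bracket3C_linear3. Qed.

Lemma bracket3C_real x y z : bracket3C (x, 0) (y, 0) (z, 0) = (b x y z, 0).
Proof.
by apply: complexificationP; rewrite /= ?(b10, b20, b30) ?subr0 ?addr0.
Qed.

Lemma bracket3C_fundamental x y z w v :
  bracket3C x y (bracket3C z w v) =
    bracket3C (bracket3C x y z) w v + bracket3C z (bracket3C x y w) v
    + bracket3C z w (bracket3C x y v).
Proof.
move: x; apply: eq_on_real => [a u u'|a u u'|x];
  rewrite ?(bC1, bC2, bC3) ?linear_sum3 //.
move: y; apply: eq_on_real => [a u u'|a u u'|y];
  rewrite ?(bC1, bC2, bC3) ?linear_sum3 //.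
move: z; apply: eq_on_real => [a u u'|a u u'|z];
  rewrite ?(bC1, bC2, bC3) ?linear_sum3 //.
move: w; apply: eq_on_real => [a u u'|a u u'|w];
  rewrite ?(bC1, bC2, bC3) ?linear_sum3 //.
move: v; apply: eq_on_real => [a u u'|a u u'|v];
  rewrite ?(bC1, bC2, bC3) ?linear_sum3 //.
rewrite !bracket3C_real bracket3_fundamental.
by apply: complexificationP; rewrite /= ?addr0.
Qed.

Definition complexification_lie3 : lie3 gC :=
  Lie3 bracket3C_linear1 bracket3C_linear2 bracket3C_linear3
       bracket3C_skew12 bracket3C_skew23 bracket3C_fundamental.

End Complexification.

(* Main.v *)
Require Import Defs.
From HB Require Import structures.
From mathcomp Require Import all_boot all_order all_algebra.
From mathcomp Require Import complex reals.

(** The bridge between the two sides is the graph of - J.  If J is a complex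
    structure, the eigenspace of its complexification for the eigenvalue i is
    q = {x - i J x | x in g}; the eigenspace for - i is {x + i J x}, the
    conjugate of q, and the two are complementary.  Conversely, if
    g_C = q (+) sigma(q), then u |-> Re u is a bijection from q onto g: an
    element of q with zero real part is the opposite of its conjugate, so it
    lies in both q and sigma(q) and vanishes; and the component u in q of 2 x,
    for x in g, satisfies 2 x = u + sigma(u), whence Re u = x.  Hence q is the
    graph {x - i J x} of a unique real linear map J, and stability of q under
    multiplication by i says that J^2 = - Id (graph_almost_complex).

    The bracket of x - i J x, y - i J y, z - i J z has real part
      [x,y,z] - [x,Jy,Jz] - [Jx,y,Jz] - [Jx,Jy,z]
    and imaginary part
      [Jx,Jy,Jz] - [Jx,y,z] - [x,Jy,z] - [x,y,Jz],
    so that it belongs to q exactly when J maps the first expression to the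
    opposite of the second, which is the integrability identity for J
    (graph_subalgebra3).  Thus a complex structure is the same as a graph that
    is a subalgebra; sigma(q) is then also one, since sigma commutes with the
    bracket. *)

Set Implicit Arguments.
Unset Strict Implicit.
Unset Printing Implicit Defensive.

Import GRing.Theory Num.Theory.
Local Open Scope ring_scope.
Local Open Scope complex_scope.

(** * Signs in a 3-Lie bracket *)

Section BracketOpposite.
Variables (K : fieldType) (V : lmodType K) (b : lie3 V).

Lemma bracket3N1 x y z : b (- x) y z = - b x y z.
Proof.
have b0 : b 0 y z = 0.
  by have := bracket3_linear1 b y z (-1) 0 0;
    rewrite !scaleN1r oppr0 addr0 addNr.
by have := bracket3_linear1 b y z (-1) x 0; rewrite !scaleN1r b0 !addr0.
Qed.

Lemma bracket3N2 x y z : b x (- y) z = - b x y z.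
Proof. by rewrite bracket3_skew12 bracket3N1 -bracket3_skew12. Qed.

Lemma bracket3N3 x y z : b x y (- z) = - b x y z.
Proof. by rewrite bracket3_skew23 bracket3N2 -bracket3_skew23. Qed.

Definition bracket3N := (bracket3N1, bracket3N2, bracket3N3).

End BracketOpposite.

(** * Graphs in the complexification *)

Section Graphs.
Variables (R : rcfType) (g : vectType R).
Local Notation gC := (complexification g).
Implicit Types (q p : {vspace gC}) (J : 'End(g)) (b : lie3 g).

Lemma complex_conjK : involutive (@complex_conj R g).
Proof. by case=> x y; rewrite /complex_conj /= opprK. Qed.

Lemma scale_i (u : gC) : 'i *: u = (- u.2, u.1) :> gC.
Proof.
by apply: complexificationP; rewrite /= !scale0r !scale1r ?sub0r ?add0r.
Qed.

Lemma scale_real (a : R) (u : gC) : a%:C *: u = (a *: u.1, a *: u.2) :> gC.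
Proof. by apply: complexificationP; rewrite /= !scale0r ?subr0 ?addr0. Qed.

Lemma bracket3C_conj b u v w :
  bracket3C b (complex_conj u) (complex_conj v) (complex_conj w)
  = complex_conj (bracket3C b u v w).
Proof.
by apply: complexificationP; rewrite /= !bracket3N ?opprK // !opprD opprK.
Qed.

Lemma almost_complex_opp J :
  almost_complex_structure J -> almost_complex_structure (- J).
Proof. by move=> JJ x; rewrite !opp_lfunE linearN /= opprK JJ. Qed.

(** The space q is {x - i J x | x in g}. *)
Definition is_graph q J : Prop := forall u : gC, (u \in q) = (u.2 == - J u.1).

(** A complex subspace is stable under i, which sends x - i J x to J x + i x;
    for this to lie on the graph again, x = - J (J x). *)
Lemma graph_almost_complex q J : is_graph q J -> almost_complex_structure J.
Proof.
move=> qJ x; have xq : ((x, - J x) : gC) \in q by rewrite qJ.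
move/(memvZ 'i): xq; rewrite scale_i qJ /= opprK => /eqP {2}->.
by rewrite opprK.
Qed.

Lemma conj_graph q p J : is_graph q J -> is_graph p (- J) ->
  forall v : gC, v \in p <-> exists2 u, u \in q & v = complex_conj u.
Proof.
move=> qJ pJ v; rewrite pJ opp_lfunE opprK; split=> [/eqP v2|[u + ->]].
  by exists (complex_conj v); rewrite ?complex_conjK // qJ /= v2.
by rewrite qJ => /eqP u2; rewrite /= u2 opprK.
Qed.

(** J applied to the real part of the bracket of three elements of the graph
    is the opposite of its imaginary part exactly when the integrability
    identity holds. *)
Lemma graph_subalgebra3 b q J : is_graph q J ->
  complex_structure b J <-> subalgebra3 (complexification_lie3 b) q.
Proof.
move=> qJ.
have key x y z :
    (J (b x y z) =
      - b (J x) (J y) (J z) + b (J x) y z + b x (J y) z + b x y (J z)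
      + J (b (J x) (J y) z) + J (b x (J y) (J z)) + J (b (J x) y (J z))) <->
    (complexification_lie3 b (x, - J x) (y, - J y) (z, - J z) \in q).
  rewrite qJ /= !bracket3N !opprK !linearB /= !opprK.
  set A := J (b x y z); set B1 := J (b x _ _); set B2 := J (b _ y _).
  set B3 := J (b _ _ z); set D := b (J x) (J y) (J z).
  set C1 := b (J x) y z; set C2 := b x (J y) z; set C3 := b x y (J z).
  have -> : - D + C1 + C2 + C3 + B3 + B1 + B2
            = (- D + C1 + C2 + C3) + (B1 + B2 + B3).
    by rewrite -!addrA; do 4 congr (_ + _); rewrite addrC -addrA.
  have -> : - C1 - C2 - C3 + D = - (- D + C1 + C2 + C3).
    by rewrite !opprD opprK addrC !addrA.
  have -> : - A + B1 + B2 + B3 = - (A - (B1 + B2 + B3)).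
    by rewrite opprB [RHS]addrC !addrA.
  by split=> [->|/eqP/oppr_inj ->]; rewrite ?addrK ?subrK.
split=> [[_ JP] u v w|sub].
  case: u v w => [x x'] [y y'] [z z'].
  rewrite (qJ (x, x')) (qJ (y, y')) (qJ (z, z')).
  by move=> /eqP/= -> /eqP/= -> /eqP/= ->; apply/key/JP.
split=> [|x y z]; first exact: graph_almost_complex qJ.
by apply/key/sub; rewrite qJ.
Qed.

Lemma subalgebra3_conj b q p :
  (forall v : gC, v \in p <-> exists2 u, u \in q & v = complex_conj u) ->
  subalgebra3 (complexification_lie3 b) q ->
  subalgebra3 (complexification_lie3 b) p.
Proof.
move=> pq sub _ _ _ /pq[u uq ->] /pq[v vq ->] /pq[w wq ->].
apply/pq; exists (bracket3C b u v w); last exact: bracket3C_conj.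
exact: sub.
Qed.

Section GraphSpace.
Variable J : 'End(g).

(** J_C - i, whose kernel is the graph when J^2 = - Id. *)
Definition graph_eq (u : gC) : gC := (J u.1 + u.2, J u.2 - u.1).

Lemma graph_eq_linear : linear graph_eq.
Proof.
have graph_eqD u v : graph_eq (u + v) = graph_eq u + graph_eq v.
  apply: complexificationP; rewrite /= linearD ?opprD /=; exact: addrACA.
have graph_eqZ (a : R) u : graph_eq (a%:C *: u) = a%:C *: graph_eq u.
  by rewrite !scale_real; apply: complexificationP;
    rewrite /= linearZ /= scalerDr ?scalerN.
have graph_eqi u : graph_eq ('i *: u) = 'i *: graph_eq u.
  rewrite !scale_i; apply: complexificationP; rewrite /= ?linearN /=.
    by rewrite opprB addrC.
  by rewrite opprK.
move=> a u v; rewrite graph_eqD (complexE a) scalerDl -scalerA graph_eqD.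
by rewrite scalerDl -scalerA graph_eqi !graph_eqZ.
Qed.

HB.instance Definition _ :=
  GRing.isLinear.Build R[i] gC gC _ graph_eq graph_eq_linear.

Definition graph_space : {vspace gC} := lker (linfun graph_eq).

Lemma graph_spaceP : almost_complex_structure J -> is_graph graph_space J.
Proof.
move=> JJ u; rewrite memv_ker lfunE /=; apply/eqP/eqP=> [[/eqP]|u2].
  by rewrite addrC addr_eq0 => /eqP.
by apply/complexificationP; rewrite /= u2 ?subrr // linearN /= JJ opprK subrr.
Qed.

End GraphSpace.

(** * Decompositions and graphs *)

(** A point on both graphs has J x = - J x, hence x = 0; and (x, y) is the sum
    of the points over (x + J y) / 2 and (x - J y) / 2. *)
Lemma graph_decomposition q p J : is_graph q J -> is_graph p (- J) ->
  directv (q + p) /\ (q + p)%VS = fullv.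
Proof.
move=> qJ pJ; have JJ := graph_almost_complex qJ.
have two : (2%:R : R) != 0 by rewrite pnatr_eq0.
split.
  apply/directv_addP/eqP; rewrite -subv0; apply/subvP => u.
  rewrite memv_cap memv0 qJ pJ opp_lfunE opprK => /andP[/eqP u2].
  rewrite u2 eq_sym -addr_eq0 -mulr2n -scaler_nat scaler_eq0 (negPf two) /=.
  move=> /eqP Ju.
  apply/eqP/complexificationP; rewrite /= ?u2 ?Ju ?oppr0 //.
  by rewrite -[u.1]opprK -(JJ u.1) Ju linear0 oppr0.
apply/eqP; rewrite eqEsubv subvf; apply/subvP => -[x y] _.
pose s := 2%:R^-1 *: (x + J y); pose t := 2%:R^-1 *: (x - J y).
have half (c d e : g) : c + e = 2%:R *: d -> 2%:R^-1 *: c + 2%:R^-1 *: e = d.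
  by rewrite -scalerDr => ->; rewrite scalerA mulVf // scale1r.
have -> : (x, y) = ((s, - J s) : gC) + ((t, J t) : gC).
  apply: complexificationP => /=; apply/esym.
    by apply: half; rewrite addrACA subrr addr0 scaler_nat mulr2n.
  rewrite /s /t !linearZ /=; apply: half.
  rewrite linearD linearB /= JJ opprD !opprK addrACA addNr add0r.
  by rewrite scaler_nat mulr2n.
by apply: memv_add; rewrite ?qJ ?pJ ?opp_lfunE ?opprK.
Qed.

Section GraphOfDecomposition.
Variables q p : {vspace gC}.
Hypotheses (qp0 : (q :&: p = 0)%VS) (qp1 : (q + p)%VS = fullv).
Hypothesis pq :
  forall v : gC, v \in p <-> exists2 u, u \in q & v = complex_conj u.

Let p_conj u : u \in q -> complex_conj u \in p.
Proof. by move=> uq; apply/pq; exists u. Qed.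

Let qp_eq0 u : u \in q -> u \in p -> u = 0.
Proof.
by move=> uq up; apply/eqP; rewrite -memv0 -qp0 memv_cap uq.
Qed.

Lemma real_part_inj u v : u \in q -> v \in q -> u.1 = v.1 -> u = v.
Proof.
move=> uq vq uv; apply/eqP; rewrite -subr_eq0; apply/eqP.
have wq : u - v \in q by apply: memvB.
apply: qp_eq0 => //; have -> : u - v = - complex_conj (u - v).
  by apply: complexificationP; rewrite /= ?opprK // uv subrr oppr0.
by rewrite memvN p_conj.
Qed.

(** The component in q of the real vector 2 x. *)
Definition real_lift (x : g) : gC := daddv_pi q p ((2%:R *: x, 0) : gC).

Lemma real_lift_mem x : real_lift x \in q.
Proof. exact: memv_pi. Qed.

(** If 2 x = u + sigma(w) with u, w in q, conjugation gives
    2 x = w + sigma(u), so u = w by uniqueness and 2 x = 2 Re u. *)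
Lemma real_lift1 x : (real_lift x).1 = x.
Proof.
have two : (2%:R : R) != 0 by rewrite pnatr_eq0.
set u := real_lift x; pose v : gC := daddv_pi p q ((2%:R *: x, 0) : gC).
have uv : u + v = (2%:R *: x, 0) by apply: daddv_pi_add; rewrite ?qp1 ?memvf.
have uq : u \in q := real_lift_mem x.
have /pq[w wq vw] : v \in p by apply: memv_pi.
have uw : u = w.
  apply/eqP; rewrite -subr_eq0; apply/eqP/qp_eq0; first exact: memvB.
  have -> : u - w = complex_conj (u - w).
    apply: complexificationP => //=.
    move/(congr1 snd): uv; rewrite vw /= => -> ; exact/esym/oppr0.
  by apply: p_conj; apply: memvB.
apply: (scalerI two); move/(congr1 fst): uv; rewrite vw -uw /= => <-.
by rewrite scaler_nat mulr2n.
Qed.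

Definition decomposition_map (x : g) : g := - (real_lift x).2.

Lemma decomposition_map_linear : linear decomposition_map.
Proof.
move=> a x y; rewrite /decomposition_map scalerN -opprD.
suff -> : real_lift (a *: x + y) = a%:C *: real_lift x + real_lift y.
  by rewrite scale_real.
apply: real_part_inj; first exact: real_lift_mem.
  by rewrite memvD ?memvZ ?real_lift_mem.
by rewrite scale_real /= !real_lift1.
Qed.

HB.instance Definition _ :=
  GRing.isLinear.Build R g g _ decomposition_map decomposition_map_linear.

Lemma decomposition_graph : is_graph q (linfun decomposition_map).
Proof.
move=> u; rewrite lfunE /= opprK.
apply/idP/eqP => [uq|u2]; first by congr snd; apply: real_part_inj;
  rewrite ?real_lift1 ?real_lift_mem.
suff -> : u = real_lift u.1 by apply: real_lift_mem.
by apply: complexificationP; rewrite ?real_lift1.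
Qed.

End GraphOfDecomposition.

End Graphs.

Theorem theorem6p4 (R : realType) (g : vectType R) (b : lie3 g) :
  (exists J : 'End(g), complex_structure b J) <->
  (exists q p : {vspace complexification g},
     [/\ directv (q + p),
         (q + p)%VS = fullv,
         (forall v : complexification g,
            v \in p <-> exists2 u, u \in q & v = complex_conj u),
         subalgebra3 (complexification_lie3 b) q &
         subalgebra3 (complexification_lie3 b) p]).
Proof.
split=> [[J Jb]|[q [p [/directv_addP qp0 qp1 pq sub _]]]].
  have JJ : almost_complex_structure J by case: Jb.
  have qJ := graph_spaceP JJ.
  have pJ : is_graph (graph_space (- J)) (- J).
    exact/graph_spaceP/almost_complex_opp.
  have [dir full] := graph_decomposition qJ pJ.
  have conj := conj_graph qJ pJ; have sub := (graph_subalgebra3 b qJ).1 Jb.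
  exists (graph_space J), (graph_space (- J)).
  exact: And5 dir full conj sub (subalgebra3_conj conj sub).
exists (linfun (decomposition_map q p)).
exact/(graph_subalgebra3 b (decomposition_graph qp0 qp1 pq)).
Qed.
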